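(* Let $(X,\nu)$ be a standard Borel space with a non-atomic finite measure $\nu$, $\theta=\nu(X)>0$, and let $a:X\to\mathbb{R}_+$ be a measurable function with $\int_X|\log a(x)|\,d\nu(x)<\infty$. Let $\mu_a$ be the distribution of the linear functional $f_a(\eta)=\int_Xa(x)\,d\eta(x)$ with respect to the law $\bar P_\Gamma$ of the normalized gamma process, and let $\nu_a$ be the distribution of the function $a$ with respect to the normalized parameter measure $\nu/\theta$. Then $\mu_a$ and $\nu_a$ are related by the following integral identity, for $z\ge0$: $$\int_{\mathbb{R}}\frac1{(1+zu)^\theta}\,d\mu_a(u)=\exp\left(-\int_{\mathbb{R}}\log(1+zu)^\theta\,d\nu_a(u)\right).$$
   Context: The gamma process on $(X,\nu)$ is the random finite positive discrete measure $\eta$ on $X$ whose law $P_\Gamma$ (the gamma measure) is determined by $\mathbb{E}\left[\exp\left(-\int_X a\,d\eta\right)\right]=\exp\left(-\int_X\log(1+a)\,d\nu\right)$ for every non-negative bounded Borel function $a$ on $X$. The normalized gamma process is $\eta/\eta(X)$, and $\bar P_\Gamma$ is its law. For $a$ as in the claim, the functional $f_a$ is finite almost surely. $\log(1+zu)^\theta$ means $\theta\log(1+zu)$. *)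

(* Defs.v *)
From HB Require Import structures.
From mathcomp Require Import all_boot all_order all_algebra.
From mathcomp Require Import all_classical all_reals all_analysis.
From mathcomp Require Import measurable_realfun.

Set Implicit Arguments.
Unset Strict Implicit.
Unset Printing Implicit Defensive.

Import Order.TTheory GRing.Theory Num.Theory.
Import numFieldNormedType.Exports.

Local Open Scope classical_set_scope.
Local Open Scope ring_scope.

(* A Polish space is presented as a Hausdorff, second countable, complete
   pseudometric space; [X] carries its Borel sigma-algebra, transported along a
   bijection. *)
Definition standard_borel (R : realType) d (X : measurableType d) : Prop :=
  exists (T : completePseudoMetricType R) (f : X -> T),
    [/\ hausdorff_space T, @second_countable T, bijective f &
        forall A : set X, measurable A <-> <<s (@open T) >> (f @` A)].

Definition nonatomic (R : realType) d (X : measurableType d)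
    (mu : set X -> \bar R) : Prop :=
  forall A, measurable A -> (0 < mu A)%E ->
    exists B, [/\ measurable B, B `<=` A, (0 < mu B)%E & (mu B < mu A)%E].

Definition is_discrete (R : realType) d (X : measurableType d)
    (mu : set X -> \bar R) : Prop :=
  exists (x : nat -> X) (w : nat -> R), (forall n, 0 <= w n) /\
    forall A, measurable A -> (mu A = \sum_(n <oo) (w n)%:E * \d_(x n) A)%E.

Record discrete_measure (R : realType) d (X : measurableType d) : Type :=
  DiscreteMeasure {
    dmeasure :> {measure set X -> \bar R} ;
    dmeasure_finite : (dmeasure [set: X] < +oo)%E ;
    dmeasure_discrete : is_discrete dmeasure }.
Arguments discrete_measure R {d} X.

Section discrete_measure_space.
Context (R : realType) d (X : measurableType d).

HB.instance Definition _ := gen_eqMixin (discrete_measure R X).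
HB.instance Definition _ := gen_choiceMixin (discrete_measure R X).

Lemma dirac_finite (x : X) : (\d_x [set: X] < +oo :> \bar R)%E.
Proof. by rewrite diracT ltry. Qed.

Lemma dirac_discrete (x : X) : is_discrete (\d_x : set X -> \bar R).
Proof.
exists (fun=> x), (fun n => (n == 0%N)%:R); split; first by move=> n; case: eqP.
move=> A mA; rewrite (@nneseries_split _ _ 0 1) => [|n _]; last first.
  by rewrite mule_ge0// lee_fin.
rewrite eseries0 => [|n /= + _]; last by case: n => // n _; rewrite mul0e.
by rewrite big_nat1 mul1e adde0.
Qed.

HB.instance Definition _ := isPointed.Build (discrete_measure R X)
  (DiscreteMeasure (dirac_finite point) (dirac_discrete point)).

Definition evaluation_sets : set (set (discrete_measure R X)) :=
  \bigcup_(A in measurable)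
    preimage_set_system [set: discrete_measure R X] (fun eta => eta A)
      measurable.

Definition discrete_space : measurableType evaluation_sets.-sigma :=
  g_sigma_algebraType evaluation_sets.

Lemma measurable_eval (A : set X) : measurable A ->
  measurable_fun [set: discrete_space] (fun eta : discrete_space => eta A).
Proof.
move=> mA _ B mB; apply: sub_sigma_algebra.
by exists A => //; exists B.
Qed.

End discrete_measure_space.
Arguments discrete_space R {d} X.

Section normalization.
Context (R : realType) d (X : measurableType d).
Implicit Types eta : discrete_space R X.

(* [mnormalize eta \d_point] is [eta / eta X] when [0 < eta X]; the default
   [\d_point] is only used for the zero measure, which the gamma measure does
   not charge. *)

Lemma mnormalize_finite eta : (mnormalize eta \d_point [set: X] < +oo)%E.
Proof. by rewrite probability_setT ltry. Qed.

Lemma mnormalize_discrete eta : is_discrete (mnormalize eta \d_point).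
Proof.
rewrite /mnormalize; case: ifPn => _; first exact: dirac_discrete.
have [x [w [w0 etaE]]] := dmeasure_discrete eta.
have c0 : 0 <= (fine (eta [set: X]))^-1 by rewrite invr_ge0 fine_ge0.
exists x, (fun n => (fine (eta [set: X]))^-1 * w n); split.
  by move=> n; rewrite mulr_ge0.
move=> A mA; rewrite etaE// muleC -nneseriesZl//.
  by apply: eq_eseriesr => n _; rewrite EFinM muleA.
by move=> n _; rewrite mule_ge0// lee_fin.
Qed.

Definition normalization eta : discrete_space R X :=
  DiscreteMeasure (mnormalize_finite eta) (mnormalize_discrete eta).

Lemma measurable_normalization :
  measurable_fun [set: discrete_space R X] normalization.
Proof.
apply: (measurability (@evaluation_sets R d X : set (set (discrete_space R X)))) => //.
move=> _ [_ [A mA [B mB <-]] <-]; rewrite !setTI.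
suff: measurable_fun [set: discrete_space R X]
    (fun eta : discrete_space R X => mnormalize eta \d_point A).
  by move=> /(_ measurableT B mB); rewrite setTI.
rewrite (_ : (fun eta => _) = fun eta : discrete_space R X =>
  if (eta [set: X] == 0)%E || (eta [set: X] == +oo)%E then \d_point A
  else (eta A * (fine (eta [set: X]))^-1%:E)%E); last first.
  by apply/funext => eta; rewrite /mnormalize; case: ifP.
have mT := measurable_eval (R := R) (@measurableT _ X).
apply: measurable_fun_ifT => //.
  apply: measurable_fun_ifT => //; exact: measurable_fun_eqe.
apply: emeasurable_funM; first exact: measurable_eval.
apply/measurable_EFinP.
under eq_fun do rewrite -powR_inv1 ?fine_ge0//.
apply: (measurableT_comp (f := @powR R ^~ (-1))) => //.
exact: measurableT_comp.
Qed.

HB.instance Definition _ :=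
  isMeasurableFun.Build _ _ _ _ normalization measurable_normalization.

End normalization.

Section linear_functional.
Import HBNNSimple.
Context (R : realType) d (X : measurableType d).

Lemma measurable_integral (f : X -> \bar R) : measurable_fun [set: X] f ->
  (forall x, 0 <= f x)%E ->
  measurable_fun [set: discrete_space R X]
    (fun eta : discrete_space R X => \int[eta]_x f x)%E.
Proof.
move=> mf f0; pose g n : X -> \bar R := EFin \o nnsfun_approx measurableT mf n.
apply: (emeasurable_fun_cvg
  (fun n (eta : discrete_space R X) => \int[eta]_x g n x)%E).
  move=> n; under eq_fun do rewrite integralT_nnsfun sintegralE.
  apply: emeasurable_fsum => //= r; apply: measurable_funeM.
  exact: measurable_eval.
move=> eta _.
rewrite (_ : integral _ _ _ = \int[eta]_x limn (g ^~ x))%E; last first.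
  by apply: eq_integral => t _; apply/esym/cvg_lim => //; exact: cvg_nnsfun_approx.
apply: cvg_monotone_convergence => //.
- by move=> n; exact/measurable_EFinP.
- by move=> n x _; rewrite lee_fin.
- by move=> t _ n m nm; apply/lefP/nd_nnsfun_approx.
Qed.

(* Real-valued integral: it returns 0 when [\int[eta]_x a x] is infinite. *)
Definition linear_functional (a : {mfun X >-> R}) (eta : discrete_space R X) : R :=
  \int[eta]_x a x.

Variable a : {mfun X >-> R}.

Lemma measurable_linear_functional :
  measurable_fun [set: discrete_space R X] (linear_functional a).
Proof.
have ma : measurable_fun [set: X] (EFin \o a) by exact/measurable_EFinP.
apply: (measurableT_comp (f := @fine R)) => //.
rewrite (_ : (fun eta => _) = fun eta : discrete_space R X =>
  (\int[eta]_x (EFin \o a)^\+ x - \int[eta]_x (EFin \o a)^\- x)%E); last first.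
  by apply/funext => eta; rewrite integralE.
apply: emeasurable_funB.
  by apply: measurable_integral => //; exact: measurable_funepos.
by apply: measurable_integral => //; exact: measurable_funeneg.
Qed.

HB.instance Definition _ := isMeasurableFun.Build _ _ _ _
  (linear_functional a) measurable_linear_functional.

End linear_functional.

(* The law of the gamma process on [(X, nu)], as a probability on the finite
   positive discrete measures with the sigma-algebra of the evaluations
   [eta |-> eta A]; the Laplace functional characterizes it. *)
Definition gamma_measure (R : realType) d (X : measurableType d)
    (nu : {measure set X -> \bar R}) (P : probability (discrete_space R X) R) :
    Prop :=
  forall a : {mfun X >-> R}, (forall x, 0 <= a x) ->
    (exists M : R, forall x, a x <= M) ->
    ('E_P[fun eta => expR (- \int[eta]_x a x)] =
       (expR (- \int[nu]_x ln (1 + a x)))%:E)%E.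

Definition normalized_law (R : realType) d (X : measurableType d)
    (P : probability (discrete_space R X) R) :
    probability (discrete_space R X) R :=
  distribution P (@normalization R d X).

(* Main.v *)
Require Import Defs.
From HB Require Import structures.
From mathcomp Require Import all_boot all_order all_algebra.
From mathcomp Require Import all_classical all_reals all_analysis.
From mathcomp Require Import measurable_realfun.
From mathcomp Require Import ring lra.

Set Implicit Arguments.
Unset Strict Implicit.
Unset Printing Implicit Defensive.

Import Order.TTheory GRing.Theory Num.Theory.
Import numFieldNormedType.Exports.

Local Open Scope classical_set_scope.
Local Open Scope ring_scope.

(** Write [S] for the total mass of [eta], [F] for the integral of [a] with
respect to [eta], and [N = S + z F].  Since the linear functional of the
normalized measure is [F / S], the left-hand side of the identity is
[E ((S / N) ^ theta)], while the Laplace functional of the gamma process turns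
the right-hand side into [E (exp (- z F))].  So the theorem says that these two
expectations agree.

The reason is the quasi-invariance of the gamma measure under scaling: tilting
its law by the density [exp (- (c - 1) S)] amounts, up to the factor
[c ^ (- theta)], to replacing [eta] by [eta / c].  For the exponentials of
linear combinations of [S] and [F] this is read off the Laplace functional,
because [ln (c y) = ln c + ln y] and [nu] has mass [theta].  To use it for
the non-exponential weight [S ^ theta], note that, for an integer
[n > theta], the number [y ^ theta] is a multiple of the integral over [r > 0]
of [(1 - exp (- r y)) ^ n r ^ (- theta - 1)], and that the [n]-th power expands
into exponentials.  This gives, for every [c > 0] ([quasi_inv_powR]),
  [E ((c S) ^ theta exp (- (c S + z F)))
     = c ^ (- theta) E (S ^ theta exp (- N / c))].
Integrating both sides against [dc / c] on the half-line, the left one becomes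
[Gamma (theta) E (exp (- z F))] and, after the change of variable [c -> 1 / c],
the right one becomes [Gamma (theta) E (S ^ theta N ^ (- theta))]
([quasi_inv_identity]).

This argument covers bounded [a], for which the Laplace functional is given.
The general case follows by truncating [a] at level [n] and letting [n] tend to
infinity.  The Laplace functional at [z a], as [z] tends to [0], shows that [F]
is almost surely finite ([functional_finite_ae]), and dominated convergence
passes the identity to the limit ([markov_krein_gamma]). *)

(** * Extended-real arithmetic *)

Lemma mule_gt0_inj (R : realType) (C x y : \bar R) : (0 < C)%E -> (C < +oo)%E ->
  (C * x = C * y)%E -> x = y.
Proof.
move=> C0 Coo; have Cfin : C \is a fin_num by rewrite ge0_fin_numE// ltW.
rewrite -(fineK Cfin) in C0 *; move: C0; rewrite lte_fin => C0.
move=> /(congr1 (mule (fine C)^-1%:E)).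
by rewrite !muleA -!EFinM mulVf ?gt_eqF// !mul1e.
Qed.

Lemma muleBr_fin (R : realType) (k : R) (x y : \bar R) :
  x \is a fin_num -> y \is a fin_num ->
  (k%:E * x - k%:E * y = k%:E * (x - y))%E.
Proof. by move=> fx fy; rewrite muleBr// fin_num_adde_defr. Qed.

Lemma fine_gt0_muleEFin (R : realType) (r : R) (y : \bar R) : 0 < r ->
  fine (r%:E * y)%E = r * fine y.
Proof.
by move=> r0; case: y => [y| |]; rewrite ?gt0_muley ?gt0_muleNy ?lte_fin//= mulr0.
Qed.

(** * The multiplicative Haar measure, in logarithmic coordinates *)
Lemma lebesgue_measureD (R : realType) (h : R) (A : set R) : measurable A ->
  pushforward lebesgue_measure ((fun x => x + h) : _ -> measurableTypeR R) A
  = lebesgue_measure A.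
Proof.
move=> mA.
have mh : measurable_fun [set: measurableTypeR R]
    ((fun x => x + h) : _ -> measurableTypeR R) by exact: measurable_funD.
pose sh : {mfun measurableTypeR R >-> measurableTypeR R} :=
  HB.pack (fun x : R => x + h) (isMeasurableFun.Build _ _ _ _ _ mh).
rewrite -[LHS]/(pushforward lebesgue_measure sh A).
apply/esym/lebesgue_measure_unique => //= _ [[a b]] _ <-.
rewrite /pushforward (_ : _ @^-1` _ = [set` `](a - h), (b - h)]]); last first.
  by apply/seteqP; split=> x /=; rewrite !in_itv/= ltrBlDr lerBrDr.
rewrite /= !lebesgue_measure_itv/= !lte_fin ltrD2r.
by case: ifP => // _; rewrite -!EFinB; congr EFin; ring.
Qed.

Lemma ge0_integral_shift (R : realType) (h : R) (f : R -> \bar R) :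
  measurable_fun [set: R] f -> (forall x, 0 <= f x)%E ->
  (\int[lebesgue_measure]_x f (x + h)%R = \int[lebesgue_measure]_x f x)%E.
Proof.
move=> mf f0.
have mh : measurable_fun [set: measurableTypeR R]
    ((fun x => x + h) : _ -> measurableTypeR R) by exact: measurable_funD.
rewrite -[LHS](@ge0_integral_pushforward _ _ _ _ _ _ mh lebesgue_measure setT f)//=.
apply: eq_measure_integral => A mA _; exact: lebesgue_measureD.
Qed.

Lemma ge0_integral_opp (R : realType) (f : R -> \bar R) :
  measurable_fun [set: R] f -> (forall x, 0 <= f x)%E ->
  (\int[lebesgue_measure]_x f (- x)%R = \int[lebesgue_measure]_x f x)%E.
Proof.
move=> mf f0.
have mN : measurable_fun [set: measurableTypeR R]
    (-%R : _ -> measurableTypeR R) by exact: oppr_measurable.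
rewrite -[LHS](@ge0_integral_pushforward _ _ _ _ _ _ mN lebesgue_measure setT f)//=.
apply: eq_measure_integral => A mA _; exact: lebesgue_measureN.
Qed.

(** The Mellin transform, the integral of [u ^ p * g u] against [du / u] on the
half-line, written with [u = expR x].  In this coordinate the invariance of
[du / u] under scaling and inversion is the invariance of the Lebesgue measure
under translation and reflection. *)
Definition mellin (R : realType) (p : R) (g : R -> R) : \bar R :=
  (\int[lebesgue_measure]_x (expR (p * x) * g (expR x))%:E)%E.

Lemma mellin_scale (R : realType) (p : R) (g : R -> R) (y : R) :
  measurable_fun [set: R] g -> (forall u, 0 < u -> 0 <= g u) -> 0 < y ->
  (\int[lebesgue_measure]_x (expR (p * x) * g (expR x * y))%:E =
    (y `^ (- p))%:E * mellin p g)%E.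
Proof.
move=> mg g0 y0.
have mF : measurable_fun [set: R] (fun x => (expR (p * x) * g (expR x))%:E).
  apply/measurable_EFinP; apply: measurable_funM.
    by apply: measurableT_comp => //; exact: measurable_funM.
  exact: measurableT_comp.
rewrite /mellin -(@ge0_integral_shift _ (ln y) _ mF); last first.
  by move=> x; rewrite lee_fin mulr_ge0 ?expR_ge0// g0 ?expR_gt0.
rewrite -ge0_integralZl//=.
- apply: eq_integral => x _; rewrite -EFinM; congr EFin.
  rewrite expRD lnK ?posrE// mulrDr expRD /powR gt_eqF//.
  rewrite mulNr expRN; set e := expR (p * ln y).
  have e0 : e != 0 by rewrite gt_eqF// expR_gt0.
  by field.
- apply/measurable_EFinP; apply: measurable_funM.
    apply: measurableT_comp => //; apply: measurable_funM => //.
    exact: measurable_funD.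
  apply: measurableT_comp => //; apply: measurableT_comp => //.
  exact: measurable_funD.
- by move=> x _; rewrite lee_fin mulr_ge0 ?expR_ge0// g0 ?expR_gt0.
- by rewrite lee_fin powR_ge0.
Qed.

(** Up to a factor, the two exponential tails are the density of an exponential
law and its reflection, whose integrals are known. *)
Lemma exp_tails_integral_lty (R : realType) (F : R -> R) (K b c : R) :
  measurable_fun [set: R] F -> (forall x, 0 <= F x) -> 0 <= K ->
  0 < b -> 0 < c ->
  (forall x, 0 <= x -> F x <= K * expR (- b * x)) ->
  (forall x, x <= 0 -> F x <= K * expR (c * x)) ->
  (\int[lebesgue_measure]_x (F x)%:E < +oo)%E.
Proof.
move=> mF F0 K0 b0 c0 Fb Fc.
have mpdf r : measurable_fun [set: R] (EFin \o exponential_pdf r).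
  by apply/measurable_EFinP; exact: measurable_exponential_pdf.
have pdf0 (r x : R) : 0 < r -> (0 <= (exponential_pdf r x)%:E)%E.
  by move=> r0; rewrite lee_fin exponential_pdf_ge0// ltW.
have mpdfN r : measurable_fun [set: R] (fun x => (exponential_pdf r (- x))%:E).
  by apply: (measurableT_comp (mpdf r)).
apply: (@le_lt_trans _ _ (\int[lebesgue_measure]_x
  ((K / b)%:E * (exponential_pdf b x)%:E +
   (K / c)%:E * (exponential_pdf c (- x))%:E))%E).
  apply: ge0_le_integral => //=.
  - by move=> x _; rewrite lee_fin.
  - exact/measurable_EFinP.
  - apply: emeasurable_funD; apply: measurable_funeM; [exact: mpdf|exact: mpdfN].
  - move=> x _; have [x0|/ltW x0] := leP 0 x.
      rewrite -[leLHS]adde0; apply: leeD.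
        rewrite exponential_pdfE// -EFinM lee_fin (le_trans (Fb _ x0))//.
        by rewrite mulrA divfK// gt_eqF.
      by rewrite mule_ge0// ?lee_fin ?exponential_pdf_ge0 ?divr_ge0// ltW.
    rewrite -[leLHS]add0e; apply: leeD.
      by rewrite mule_ge0// ?lee_fin ?exponential_pdf_ge0 ?divr_ge0// ltW.
    rewrite exponential_pdfE ?oppr_ge0// -EFinM lee_fin (le_trans (Fc _ x0))//.
    by rewrite mulrA divfK ?mulrNN// gt_eqF.
rewrite ge0_integralD//=; first last.
- by apply: measurable_funeM; exact: mpdfN.
- by move=> x _; rewrite mule_ge0// ?pdf0// lee_fin divr_ge0// ltW.
- by apply: measurable_funeM; exact: mpdf.
- by move=> x _; rewrite mule_ge0// ?pdf0// lee_fin divr_ge0// ltW.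
rewrite !ge0_integralZl//=; first last.
- by rewrite lee_fin divr_ge0// ltW.
- by move=> x _; exact: pdf0.
- exact: mpdf.
- by rewrite lee_fin divr_ge0// ltW.
- by move=> x _; exact: pdf0.
- exact: mpdfN.
rewrite (ge0_integral_opp (mpdf c)) => [|x]; last exact: pdf0.
by rewrite !integral_exponential_pdf// !mule1 -EFinD ltry.
Qed.

(** If the integral vanished, then so would [F] almost everywhere, whereas the
whole line is not negligible. *)
Lemma lebesgue_integral_gt0 (R : realType) (F : R -> R) :
  measurable_fun [set: R] F -> (forall x, 0 < F x) ->
  (0 < \int[lebesgue_measure]_x (F x)%:E)%E.
Proof.
move=> mF F0.
rewrite lt0e integral_ge0 ?andbT => [|x _]; last by rewrite lee_fin ltW.
apply/eqP => IF.
have /ae_eq_integral_abs : (\int[lebesgue_measure]_x `|(F x)%:E| = 0)%E.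
  by rewrite -[RHS]IF; apply: eq_integral => x _; rewrite gee0_abs// lee_fin ltW.
move=> /(_ measurableT) /(_ _)[]; first exact/measurable_EFinP.
move=> N [mN N0 FN].
have : (lebesgue_measure [set: R] <= lebesgue_measure N)%E.
  apply: le_measure; rewrite ?inE// => x _; apply: FN => /= /(_ I)/eqP.
  by rewrite eqe gt_eqF.
by rewrite N0 -set_itvNyy lebesgue_measure_itv/=.
Qed.

Lemma measurable_mellin_integrand (R : realType) (p : R) (g : R -> R) :
  measurable_fun [set: R] g ->
  measurable_fun [set: R] (fun x => expR (p * x) * g (expR x)).
Proof.
move=> mg; apply: measurable_funM; last exact: measurableT_comp.
by apply: measurableT_comp => //; exact: measurable_funM.
Qed.

(** * The two Mellin constants *)

(** Euler's integral for the Gamma function at [p]. *)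
Definition Gamma_integral (R : realType) (p : R) : \bar R :=
  mellin p (fun u => expR (- u)).

Lemma measurable_expRN (R : realType) :
  measurable_fun [set: R] (fun u : R => expR (- u)).
Proof. exact: measurableT_comp. Qed.

Lemma Gamma_integral_gt0 (R : realType) (p : R) : (0 < Gamma_integral p)%E.
Proof.
rewrite /Gamma_integral /mellin; apply: lebesgue_integral_gt0 => [|x]; last by rewrite mulr_gt0 ?expR_gt0.
exact: (measurable_mellin_integrand _ (@measurable_expRN R)).
Qed.

(** As [x] tends to [-oo] the integrand is at most [expR (p * x)]; as [x] tends
to [+oo] it decays like [expR (- x)], because [expR (expR x)] dominates
[expR x] to any integer power greater than [p + 1]. *)
Lemma Gamma_integral_lty (R : realType) (p : R) : 0 < p ->
  (Gamma_integral p < +oo)%E.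
Proof.
move=> p0; set m := (Num.Def.trunc p).+1.
have pm : p < m%:R by exact: truncnS_gt.
rewrite /Gamma_integral /mellin; apply: (@exp_tails_integral_lty _ _ (m.+1)`!%:R 1 p) => //=.
- exact: (measurable_mellin_integrand _ (@measurable_expRN R)).
- move=> x x0.
  have fm : 0 < (m.+1)`!%:R :> R by rewrite ltr0n fact_gt0.
  have u1 : 1 <= expR x by rewrite -[leLHS]addr0 (le_trans _ (expR_ge1Dx _))// lerD2l.
  have um : expR x ^+ m.+1 <= (m.+1)`!%:R * expR (expR x).
    rewrite mulrC -ler_pdivrMr//.
    by apply: le_trans (expR_ge1Dxn m (expR_ge0 x)); rewrite lerDr.
  rewrite expRN ler_pdivrMr ?expR_gt0// mulrAC.
  apply: le_trans (ler_wpM2r (expR_ge0 _) um).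
  rewrite -expRM_natl -expRD ler_expR mulN1r -[in leRHS]natr1 mulrDl mul1r addrK.
  by rewrite ler_wpM2r// ltW.
- move=> x x0; rewrite [leLHS]mulrC ler_wpM2r ?expR_ge0//.
  apply: (@le_trans _ _ 1); last by rewrite ler1n fact_gt0.
  by rewrite -expR0 ler_expR oppr_le0 expR_ge0.
Qed.

(** The constant in the representation of [y `^ p] by exponentials: the Mellin
transform at [- p] of [(1 - exp (- u)) ^ n].  The exponent [n] compensates the
singularity of [u ^ (- p - 1)] at [0]. *)
Definition frac_power_integral (R : realType) (n : nat) (p : R) : \bar R :=
  mellin (- p) (fun u => (1 - expR (- u)) ^+ n).

Lemma measurable_pow1BexpRN (R : realType) n :
  measurable_fun [set: R] (fun u : R => (1 - expR (- u)) ^+ n).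
Proof.
by apply: measurable_funX; apply: measurable_funB => //; exact: measurable_expRN.
Qed.

Lemma frac_power_integral_gt0 (R : realType) n (p : R) : (0 < frac_power_integral n p)%E.
Proof.
rewrite /frac_power_integral /mellin; apply: lebesgue_integral_gt0 => [|x].
  exact: (measurable_mellin_integrand _ (@measurable_pow1BexpRN R n)).
by rewrite mulr_gt0 ?expR_gt0// exprn_gt0// subr_gt0 -expR0 ltr_expR oppr_lt0 expR_gt0.
Qed.

(** The hypothesis [p < n] makes the integral converge at [u = 0], where
[(1 - exp (- u)) ^ n] is at most [u ^ n]; [0 < p] makes it converge at
infinity. *)
Lemma frac_power_integral_lty (R : realType) n (p : R) : 0 < p -> p < n%:R ->
  (frac_power_integral n p < +oo)%E.
Proof.
move=> p0 pn.
have e1 (u : R) : 0 <= u -> 0 <= 1 - expR (- u).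
  by move=> u0; rewrite subr_ge0 -expR0 ler_expR oppr_le0.
rewrite /frac_power_integral /mellin; apply: (@exp_tails_integral_lty _ _ 1 p (n%:R - p)) => //=.
- exact: (measurable_mellin_integrand _ (@measurable_pow1BexpRN R n)).
- by rewrite subr_gt0.
- move=> x x0; rewrite [leLHS]mulrC ler_wpM2r ?expR_ge0//.
- move=> x x0; have -> : (n%:R - p) * x = - p * x + n%:R * x by ring.
  rewrite mul1r expRD ler_wpM2l ?expR_ge0//.
  rewrite expRM_natl lerXn2r ?nnegrE ?e1 ?expR_ge0//.
  by rewrite lerBlDr -lerBlDl; apply: le_trans (expR_ge1Dx _).
Qed.

(** For [y > 0] this is scaling invariance; for [y = 0] both sides vanish, on the
left because [n] is positive. *)
Lemma powR_frac_power_integral (R : realType) n (p y : R) : 0 < p -> p < n%:R -> 0 <= y ->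
  (\int[lebesgue_measure]_x (expR (- p * x) * (1 - expR (- (expR x * y))) ^+ n)%:E
   = (y `^ p)%:E * frac_power_integral n p)%E.
Proof.
move=> p0 pn; rewrite le_eqVlt => /predU1P[<-|y0].
  rewrite powR0 ?gt_eqF// mul0e; apply: integral0_eq => x _.
  rewrite mulr0 oppr0 expR0 subrr expr0n mulrC.
  by case: n pn => [|n _]; rewrite ?mul0r// ltNge ltW.
rewrite (@mellin_scale _ _ (fun u => (1 - expR (- u)) ^+ n)) ?opprK//.
  exact: measurable_pow1BexpRN.
by move=> u u0; rewrite exprn_ge0// subr_ge0 -expR0 ler_expR oppr_le0 ltW.
Qed.

(** * Mellin transforms under the expectation *)
Section tonelli.
Context (R : realType) d (T : measurableType d) (P : probability T R).

Lemma measurable_mellin_param (p : R) (g : R -> R) (Y G : T -> R) :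
  measurable_fun [set: R] g ->
  measurable_fun [set: T] Y -> measurable_fun [set: T] G ->
  measurable_fun [set: measurableTypeR R * T]
    (fun xw => (expR (p * xw.1) * g (expR xw.1 * Y xw.2) * G xw.2)%:E).
Proof.
move=> mg mY mG; apply/measurable_EFinP.
have m1 : measurable_fun [set: measurableTypeR R * T]
   (fun xw => xw.1 : R) by exact: measurable_fst.
apply: measurable_funM; last by apply: measurableT_comp => //; exact: measurable_snd.
apply: measurable_funM.
  by apply: measurableT_comp => //; exact: measurable_funM.
apply: (measurableT_comp mg); apply: measurable_funM.
  exact: measurableT_comp.
by apply: measurableT_comp => //; exact: measurable_snd.
Qed.

(** The form of Tonelli's theorem used for both constants.  The inner integral
needs to be known only where [G] does not vanish: the Gamma integral of
[expR x * Y w] diverges when [Y w = 0]. *)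
Lemma tonelli_mellin (p : R) (g : R -> R) (M : \bar R) (Y V G : T -> R) :
  measurable_fun [set: R] g -> (forall u, 0 <= u -> 0 <= g u) ->
  measurable_fun [set: T] Y -> (forall w, 0 <= Y w) ->
  measurable_fun [set: T] V -> (forall w, 0 <= V w) ->
  measurable_fun [set: T] G -> (forall w, 0 <= G w) -> (0 <= M)%E ->
  (forall w, (G w != 0)%R ->
    \int[lebesgue_measure]_x (expR (p * x) * g (expR x * Y w))%:E
    = (V w)%:E * M)%E ->
  (\int[lebesgue_measure]_x \int[P]_w
      (expR (p * x) * g (expR x * Y w) * G w)%:E
   = M * \int[P]_w (V w * G w)%:E)%E.
Proof.
move=> mg g0 mY Y0 mV V0 mG G0 M0 VM.
have mH := measurable_mellin_param p mg mY mG.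
have H0 (xw : measurableTypeR R * T) :
    (0 <= (expR (p * xw.1) * g (expR xw.1 * Y xw.2) * G xw.2)%:E)%E.
  by rewrite lee_fin !mulr_ge0 ?expR_ge0 ?g0 ?mulr_ge0 ?expR_ge0.
rewrite (@fubini_tonelli _ _ _ _ _ (@lebesgue_measure R) P _ mH H0)/=.
rewrite -ge0_integralZl//=; last first.
- by move=> w _; rewrite lee_fin mulr_ge0.
- by apply/measurable_EFinP; exact: measurable_funM.
apply: eq_integral => w _.
have [->|Gw] := eqVneq (G w) 0.
  by rewrite mulr0 mule0; apply: integral0_eq => x _; rewrite mulr0.
under eq_integral do rewrite mulrC EFinM.
rewrite ge0_integralZl ?lee_fin//=.
- by rewrite VM// EFinM muleCA [(M * _)%E]muleC muleA.
- apply/measurable_EFinP; apply: measurable_funM.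
    by apply: measurableT_comp => //; exact: measurable_funM.
  by apply: (measurableT_comp mg); apply: measurable_funM.
- by move=> x _; rewrite lee_fin mulr_ge0 ?expR_ge0 ?g0 ?mulr_ge0 ?expR_ge0.
Qed.

End tonelli.

(** * A consequence of quasi-invariance under scaling *)

(** The hypothesis [quasi_inv] says, at the level of Laplace transforms, that the
pair [(S, F)] tilted by [exp (- (c - 1) S)] has, up to the factor
[c ^ (- theta)], the law of [(S, F) / c]. *)
Section quasi_invariance.
Context (R : realType) d (T : measurableType d) (P : probability T R).
Context (theta : R) (S F : T -> R).
Hypothesis theta0 : 0 < theta.
Hypothesis mS : measurable_fun [set: T] S.
Hypothesis mF : measurable_fun [set: T] F.
Hypothesis S0 : forall w, 0 <= S w.
Hypothesis F0 : forall w, 0 <= F w.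
Hypothesis quasi_inv : forall c t s, 0 < c -> 0 <= t -> 0 <= s ->
  1 <= (1 + t) * c ->
  (\int[P]_w (expR (- (((1 + t) * c - 1) * S w + c * s * F w)))%:E =
   (c `^ (- theta))%:E * \int[P]_w (expR (- (t * S w + s * F w)))%:E)%E.

Let mlin (t s : R) : measurable_fun [set: T] (fun w => t * S w + s * F w).
Proof. by apply: measurable_funD; exact: measurable_funM. Qed.

Let mexp (t s : R) :
  measurable_fun [set: T] (fun w => expR (- (t * S w + s * F w))).
Proof. by apply: measurableT_comp => //; exact: measurableT_comp. Qed.

Let mpow n (r t s : R) : measurable_fun [set: T]
  (fun w => (1 - expR (- (r * S w))) ^+ n * expR (- (t * S w + s * F w))).
Proof.
apply: measurable_funM => //; apply: measurable_funX; apply: measurable_funB => //.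
by apply: measurableT_comp => //; apply: measurableT_comp => //; exact: measurable_funM.
Qed.

Let pow_bounded n (r t s : R) w : 0 <= r -> 0 <= t -> 0 <= s ->
  0 <= (1 - expR (- (r * S w))) ^+ n * expR (- (t * S w + s * F w)) <= 1.
Proof.
move=> r0 t0 s0; have rS : 0 <= r * S w by exact: mulr_ge0.
have a0 : 0 <= 1 - expR (- (r * S w)) by rewrite subr_ge0 -expR0 ler_expR oppr_le0.
have a1 : 1 - expR (- (r * S w)) <= 1 by rewrite lerBlDr lerDl expR_ge0.
rewrite mulr_ge0 ?exprn_ge0 ?expR_ge0//= -[leRHS]mulr1.
apply: ler_pM; rewrite ?exprn_ge0 ?expR_ge0 ?exprn_ile1//.
by rewrite -expR0 ler_expR oppr_le0 addr_ge0// mulr_ge0.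
Qed.

Let int_pow n (r t s : R) : 0 <= r -> 0 <= t -> 0 <= s ->
  P.-integrable [set: T] (EFin \o
    (fun w => (1 - expR (- (r * S w))) ^+ n * expR (- (t * S w + s * F w)))).
Proof.
move=> r0 t0 s0; apply: measurable_bounded_integrable => //.
  by rewrite (le_lt_trans (probability_le1 P measurableT))// ltry.
exists 1; split => // M M1 w _ /=.
have /andP[h0 h1] := pow_bounded n w r0 t0 s0.
by rewrite ger0_norm// (le_trans h1)// ltW.
Qed.

(** Since [(1 - x) ^ (n + 1) y = (1 - x) ^ n y - (1 - x) ^ n (x y)], and
multiplying by [x = exp (- r S)] only shifts the parameter [t] by [r],
induction on [n] with [t] generalized avoids the binomial expansion. *)
Lemma quasi_inv_pow n (r c t s : R) : 0 <= r -> 0 < c -> 0 <= t -> 0 <= s ->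
  1 <= (1 + t) * c ->
  (\int[P]_w ((1 - expR (- (r * c * S w))) ^+ n *
      expR (- (((1 + t) * c - 1) * S w + c * s * F w)))%:E =
   (c `^ (- theta))%:E * \int[P]_w ((1 - expR (- (r * S w))) ^+ n *
      expR (- (t * S w + s * F w)))%:E)%E.
Proof.
move=> r0 c0; elim: n t => [|n IH] t t0 s0 tc.
  under eq_integral do rewrite expr0 mul1r.
  rewrite quasi_inv//; congr (_ * _)%E.
  by apply: eq_integral => w _; rewrite expr0 mul1r.
have rc0 : 0 <= r * c by rewrite mulr_ge0// ltW.
have cs0 : 0 <= c * s by rewrite mulr_ge0// ltW.
have tc0 : 0 <= (1 + t) * c - 1 by rewrite subr_ge0.
have tr0 : 0 <= t + r by rewrite addr_ge0.
have trc : 1 <= (1 + (t + r)) * c by rewrite addrA mulrDl (le_trans tc)// lerDl.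
have trc0 : 0 <= (1 + (t + r)) * c - 1 by rewrite subr_ge0.
have step (x y y' : R) : y' = x * y ->
  (1 - x) ^+ n.+1 * y = (1 - x) ^+ n * y - (1 - x) ^+ n * y'.
  by move=> ->; rewrite exprS; ring.
have e1 w : (1 - expR (- (r * c * S w))) ^+ n.+1 *
      expR (- (((1 + t) * c - 1) * S w + c * s * F w)) =
    (1 - expR (- (r * c * S w))) ^+ n *
      expR (- (((1 + t) * c - 1) * S w + c * s * F w)) -
    (1 - expR (- (r * c * S w))) ^+ n *
      expR (- (((1 + (t + r)) * c - 1) * S w + c * s * F w)).
  by apply: step; rewrite -expRD; congr expR; ring.
have e2 w : (1 - expR (- (r * S w))) ^+ n.+1 * expR (- (t * S w + s * F w)) =
    (1 - expR (- (r * S w))) ^+ n * expR (- (t * S w + s * F w)) -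
    (1 - expR (- (r * S w))) ^+ n * expR (- ((t + r) * S w + s * F w)).
  by apply: step; rewrite -expRD; congr expR; ring.
under eq_integral do rewrite e1 EFinB.
under [in RHS]eq_integral do rewrite e2 EFinB.
rewrite !integralB_EFin//; try exact: int_pow.
rewrite (IH t)// (IH (t + r))//.
have f1 := integrable_fin_num measurableT (int_pow n r0 t0 s0).
have f2 := integrable_fin_num measurableT (int_pow n r0 tr0 s0).
exact: (muleBr_fin _ f1 f2).
Qed.

Let measurable_powR_comp (p : R) (Y : T -> R) : measurable_fun [set: T] Y ->
  measurable_fun [set: T] (fun w => Y w `^ p).
Proof. by move=> mY; apply: (measurableT_comp (measurable_powR p)). Qed.

(** Integrating [quasi_inv_pow] over [r = expR x] with weight [expR (- theta * x)]
replaces the [n]-th power by a fractional power.  The parameters are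
[t = 1 / c] and [s = z / c], for which [(1 + t) c - 1 = c] and [c s = z]. *)
Lemma quasi_inv_powR (c z : R) : 0 < c -> 0 <= z ->
  (\int[P]_w ((c * S w) `^ theta * expR (- (c * S w + z * F w)))%:E =
   (c `^ (- theta))%:E *
   \int[P]_w (S w `^ theta * expR (- (c^-1 * S w + z / c * F w)))%:E)%E.
Proof.
move=> c0 z0; pose n := (Num.Def.trunc theta).+1.
have ltn : theta < n%:R by exact: truncnS_gt.
have C0 := frac_power_integral_gt0 n theta.
have Coo := frac_power_integral_lty theta0 ltn.
pose g (u : R) := (1 - expR (- u)) ^+ n.
have g0 u : 0 <= u -> 0 <= g u.
  by move=> u0; rewrite exprn_ge0// subr_ge0 -expR0 ler_expR oppr_le0.
have mg : measurable_fun [set: R] g by exact: measurable_pow1BexpRN.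
have mcS : measurable_fun [set: T] (fun w => c * S w) by exact: measurable_funM.
have cS0 w : 0 <= c * S w by rewrite mulr_ge0// ltW.
have Ftonelli (Y G : T -> R) : measurable_fun [set: T] Y -> (forall w, 0 <= Y w) ->
    measurable_fun [set: T] G -> (forall w, 0 <= G w) ->
    (\int[lebesgue_measure]_x \int[P]_w
      (expR (- theta * x) * g (expR x * Y w) * G w)%:E
    = frac_power_integral n theta * \int[P]_w (Y w `^ theta * G w)%:E)%E.
  move=> mY Y0 mG G0; apply: tonelli_mellin => //.
  - exact: measurable_powR_comp.
  - by move=> w; exact: powR_ge0.
  - exact: ltW.
  - by move=> w _; rewrite -powR_frac_power_integral.
apply: (mule_gt0_inj C0 Coo).
rewrite -(Ftonelli (fun w => c * S w))//.
rewrite muleCA -Ftonelli//.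
rewrite -ge0_integralZl ?lee_fin ?powR_ge0//=; last 2 first.
- have := measurable_fun_fubini_tonelli_F (m2 := P) _ (measurable_mellin_param (- theta) mg mS (mexp c^-1 (z / c))).
  apply=> xw; rewrite lee_fin mulr_ge0 ?mulr_ge0 ?expR_ge0//.
  by apply: g0; rewrite mulr_ge0// expR_ge0.
- move=> x _; apply: integral_ge0 => w _; rewrite lee_fin mulr_ge0 ?mulr_ge0 ?expR_ge0//.
  by apply: g0; rewrite mulr_ge0// expR_ge0.
apply: eq_integral => x _.
under eq_integral do rewrite -mulrA EFinM.
under [in RHS]eq_integral do rewrite -mulrA EFinM.
rewrite !ge0_integralZl ?lee_fin ?expR_ge0//=; last 4 first.
- exact/measurable_EFinP/mpow.
- move=> w _; rewrite lee_fin mulr_ge0 ?expR_ge0//.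
  by apply: g0; rewrite mulr_ge0// expR_ge0.
- apply/measurable_EFinP; apply: measurable_funM => //.
  by apply: (measurableT_comp mg); exact: measurable_funM.
- move=> w _; rewrite lee_fin mulr_ge0 ?expR_ge0//.
  by apply: g0; rewrite mulr_ge0// expR_ge0.
rewrite [RHS]muleCA; congr (_ * _)%E.
have tc : (1 + c^-1) * c = c + 1 by rewrite mulrDl mul1r mulVf// gt_eqF.
have c10 : 0 <= c^-1 by rewrite invr_ge0 ltW.
have zc0 : 0 <= z / c by rewrite mulr_ge0.
have tc1 : 1 <= (1 + c^-1) * c by rewrite tc lerDr ltW.
rewrite -(quasi_inv_pow n (expR_ge0 x) c0 c10 zc0 tc1).
apply: eq_integral => w _; rewrite tc addrK [c * (z / c)]mulrC divfK ?gt_eqF//.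
by rewrite /g mulrA.
Qed.

(** By quasi-invariance the Laplace transform of [S] at [c - 1] is
[c ^ (- theta)], which bounds the mass of the event [S = 0] and tends to [0]. *)
Lemma quasi_inv_gt0_ae : {ae P, forall w, 0 < S w}.
Proof.
have mZ : measurable [set w | S w = 0].
  rewrite (_ : [set w | _] = S @^-1` [set 0]) -1?[X in measurable X]setTI//.
  exact: mS.
exists [set w | S w = 0]; split => //; last first.
  by move=> w /= /negP; rewrite -leNgt => S0'; apply/eqP; rewrite eq_le S0' S0.
pose Z := [set w | S w = 0]; rewrite -/Z in mZ *.
have bound (c : R) : 1 <= c -> (P Z <= (c `^ (- theta))%:E)%E.
  move=> c1; have c0 : 0 < c by exact: lt_le_trans c1.
  have := @quasi_inv c 0 0 c0 (lexx _) (lexx _); rewrite addr0 mul1r => /(_ c1).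
  rewrite [X in (_ * X)%E](_ : _ = 1%E); last first.
    rewrite -(probability_setT P) -[RHS]mul1e -integral_cst//.
    by apply: eq_integral => w _; rewrite !mul0r addr0 oppr0 expR0.
  rewrite mule1 => <-; rewrite -(setIT Z) -integral_indic//.
  apply: ge0_le_integral => //=.
  - by apply/measurable_EFinP; exact: measurable_indic.
  - exact/measurable_EFinP/mexp.
  - move=> w _; rewrite lee_fin indicE; case: (boolP (w \in _)); rewrite ?expR_ge0//.
    by move=> /set_mem Sw; rewrite Sw mulr0 mulr0 mul0r addr0 oppr0 expR0.
have Pfin : P Z \is a fin_num by exact: fin_num_measure.
move: bound; rewrite -(fineK Pfin); set p := fine _ => bound.
have p0 : 0 <= p by exact: fine_ge0.
have p1 : p <= 1 by rewrite -lee_fin (le_trans (bound 1 (lexx _)))// powR1.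
apply/eqP; rewrite eqe eq_le p0 andbT leNgt; apply/negP => pgt0.
(* this [c] solves [c ^ (- theta) = p / 2] *)
pose c := (p / 2) `^ (- theta^-1).
have c1 : 1 <= c.
  rewrite /c powRN invf_ge1 ?powR_gt0 ?divr_gt0//.
  rewrite -[leRHS](congr1 (fun f => f theta^-1) (powR1 R)) ge0_ler_powR ?nnegrE ?invr_ge0 ?divr_ge0 ?ltW//.
  by rewrite ltr_pdivrMr// mul1r (le_lt_trans p1)// ltr1n.
have := bound c c1; rewrite lee_fin /c -powRrM mulrNN mulVf ?gt_eqF// powRr1 ?divr_ge0//.
lra.
Qed.

(** Both sides of [quasi_inv_powR] at [c = expR x] are integrated over [x].  The
left one gives the Gamma integral times [exp (- z F)], the powers of [S]
cancelling where [S > 0].  The right one is a function of [- x]; reflecting it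
gives the Gamma integral times [S ^ theta N ^ (- theta)]. *)
Lemma quasi_inv_identity (z : R) : 0 <= z ->
  (\int[P]_w ((S w + z * F w) `^ (- theta) * S w `^ theta)%:E =
   \int[P]_w (expR (- (z * F w)))%:E)%E.
Proof.
move=> z0.
pose g (u : R) := expR (- u).
have g0 (u : R) : 0 <= u -> 0 <= g u by rewrite /g expR_ge0.
have mg : measurable_fun [set: R] g by exact: measurable_expRN.
have mN : measurable_fun [set: T] (fun w => S w + z * F w).
  by apply: measurable_funD => //; exact: measurable_funM.
have N0 w : 0 <= S w + z * F w by rewrite addr_ge0// mulr_ge0.
have mSt : measurable_fun [set: T] (fun w => S w `^ theta) by exact: measurable_powR_comp.
have mE : measurable_fun [set: T] (fun w => expR (- (z * F w))).
  by apply: measurableT_comp => //; apply: measurableT_comp => //; exact: measurable_funM.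
have mSE : measurable_fun [set: T] (fun w => S w `^ theta * expR (- (z * F w))).
  exact: measurable_funM.
have St0 w : 0 <= S w `^ theta by exact: powR_ge0.
have SE0 w : 0 <= S w `^ theta * expR (- (z * F w)).
  by rewrite mulr_ge0 ?expR_ge0.
have Ftonelli (Y G : T -> R) : measurable_fun [set: T] Y -> (forall w, 0 <= Y w) ->
    measurable_fun [set: T] G -> (forall w, 0 <= G w) ->
    (forall w, G w != 0 -> 0 < Y w) ->
    (\int[lebesgue_measure]_x \int[P]_w
      (expR (theta * x) * g (expR x * Y w) * G w)%:E
    = Gamma_integral theta * \int[P]_w (Y w `^ (- theta) * G w)%:E)%E.
  move=> mY Y0 mG G0 GY; apply: tonelli_mellin => //.
  - exact: measurable_powR_comp.
  - by move=> w; exact: powR_ge0.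
  - exact/ltW/Gamma_integral_gt0.
  - move=> w Gw; rewrite (mellin_scale theta mg) ?GY//.
    by move=> u /ltW; exact: g0.
have Spos w : S w `^ theta != 0 -> 0 < S w.
  rewrite lt0r S0 andbT; apply: contra_neq => ->; rewrite powR0// gt_eqF//.
have -> : (\int[P]_w (expR (- (z * F w)))%:E =
    \int[P]_w (S w `^ (- theta) * (S w `^ theta * expR (- (z * F w))))%:E)%E.
  apply: ae_eq_integral => //.
  - exact/measurable_EFinP.
  - by apply/measurable_EFinP; apply: measurable_funM => //; exact: measurable_powR_comp.
  - apply: filterS quasi_inv_gt0_ae => w Sw _; congr EFin.
    by rewrite powRN mulrA mulVf ?mul1r// gt_eqF// powR_gt0.
apply: (mule_gt0_inj (Gamma_integral_gt0 theta) (Gamma_integral_lty theta0)).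
rewrite -!Ftonelli//; last 2 first.
- by move=> w; rewrite mulf_eq0 negb_or => /andP[/Spos].
- by move=> w /Spos Sw; rewrite (lt_le_trans Sw)// lerDl mulr_ge0.
pose h x := (\int[P]_w (expR (theta * x) * g (expR x * (S w + z * F w)) * S w `^ theta)%:E)%E.
rewrite -[LHS]/(\int[lebesgue_measure]_x h x)%E -(ge0_integral_opp (f := h)); last 2 first.
- have := measurable_fun_fubini_tonelli_F (m2 := P) _ (measurable_mellin_param theta mg mN mSt).
  by apply=> xw; rewrite lee_fin mulr_ge0 ?mulr_ge0 ?expR_ge0 ?powR_ge0.
- by move=> x; apply: integral_ge0 => w _; rewrite lee_fin mulr_ge0 ?mulr_ge0 ?expR_ge0 ?powR_ge0.
apply: eq_integral => x _; rewrite /h.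
(* [h (- x)] is the right-hand side of [quasi_inv_powR] at [expR x] *)
transitivity ((expR x `^ (- theta))%:E * \int[P]_w (S w `^ theta *
    expR (- ((expR x)^-1 * S w + z / expR x * F w)))%:E)%E.
  rewrite -ge0_integralZl ?lee_fin ?powR_ge0//=; last 2 first.
  - by apply/measurable_EFinP; apply: measurable_funM => //; exact: mexp.
  - by move=> w _; rewrite lee_fin mulr_ge0 ?powR_ge0 ?expR_ge0.
  apply: eq_integral => w _; rewrite -EFinM -expRM mulrN mulrN [x * _]mulrC -mulrA; congr (_ * _)%:E.
  by rewrite mulrC; congr (_ * expR _); rewrite expRN; ring.
rewrite -quasi_inv_powR ?expR_gt0//.
apply: eq_integral => w _; congr EFin; rewrite powRM ?expR_ge0// -expRM [x * _]mulrC.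
by rewrite /g opprD expRD; ring.
Qed.

End quasi_invariance.

(** * Integration against finite and normalized measures *)
Section bounded_integrand.
Context (R : realType) d (X : measurableType d).

Lemma bounded_measurable_integrable (mu : {measure set X -> \bar R}) (f : X -> R)
    (M : R) :
  (mu [set: X] < +oo)%E -> measurable_fun [set: X] f ->
  (forall x, 0 <= f x) -> (forall x, f x <= M) ->
  mu.-integrable [set: X] (EFin \o f).
Proof.
move=> muoo mf f0 fM; apply: measurable_bounded_integrable => //.
exists M; split; first exact: num_real.
by move=> K MK x _ /=; rewrite ger0_norm// (le_trans (fM x))// ltW.
Qed.

Lemma integral_mnormalize (mu : {measure set X -> \bar R})
    (Q : probability X R) (s : R) (f : X -> \bar R) :
  mu [set: X] = s%:E -> 0 < s -> measurable_fun [set: X] f ->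
  (forall x, 0 <= f x)%E ->
  (\int[mnormalize mu Q]_x f x = (s^-1)%:E * \int[mu]_x f x)%E.
Proof.
move=> mus s0 mf f0; have s10 : 0 <= s^-1 by rewrite invr_ge0 ltW.
rewrite -(ge0_integral_mscale mu measurableT (NngNum s10) mf)//.
apply: eq_measure_integral => A mA _ /=.
by rewrite /mnormalize mus eqe gt_eqF//= /mscale/= muleC.
Qed.

End bounded_integrand.

(** * The gamma process and bounded functionals *)
Section gamma_process.
Context (R : realType) d (X : measurableType d).
Context (nu : {finite_measure set X -> \bar R}) (theta : R).
Context (P : probability (discrete_space R X) R).
Hypothesis nuT : nu [set: X] = theta%:E.
Hypothesis theta0 : 0 < theta.
Hypothesis gammaP : gamma_measure nu P.

Let S (eta : discrete_space R X) : R := fine (eta [set: X]).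

Lemma measurable_total_mass : measurable_fun [set: discrete_space R X] S.
Proof.
by apply: (measurableT_comp (f := @fine R)) => //; exact: measurable_eval.
Qed.

Lemma total_mass_ge0 eta : 0 <= S eta.
Proof. exact: fine_ge0. Qed.

Lemma total_massE (eta : discrete_space R X) : eta [set: X] = (S eta)%:E.
Proof. by rewrite fineK// ge0_fin_numE// dmeasure_finite. Qed.

Lemma gamma_laplace (b : X -> R) (M : R) : measurable_fun [set: X] b ->
  (forall x, 0 <= b x) -> (forall x, b x <= M) ->
  (\int[P]_eta (expR (- \int[eta]_x b x))%:E =
   (expR (- \int[nu]_x ln (1 + b x)))%:E)%E.
Proof.
move=> mb b0 bM.
pose b' : {mfun X >-> R} := HB.pack b (isMeasurableFun.Build _ _ _ _ _ mb).
have := @gammaP b' b0 (ex_intro _ M bM); by rewrite unlock.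
Qed.

Section bounded_functional.
Variables (a : X -> R) (M : R).
Hypothesis ma : measurable_fun [set: X] a.
Hypothesis a0 : forall x, 0 <= a x.
Hypothesis aM : forall x, a x <= M.

Let F (eta : discrete_space R X) : R := \int[eta]_x a x.

Lemma bounded_functional_ge0 eta : 0 <= F eta.
Proof. exact: Rintegral_ge0. Qed.

Lemma measurable_bounded_functional : measurable_fun [set: discrete_space R X] F.
Proof.
pose a' : {mfun X >-> R} := HB.pack a (isMeasurableFun.Build _ _ _ _ _ ma).
exact: (measurable_linear_functional a').
Qed.

Let lnint (t s : R) : 0 <= t -> 0 <= s ->
  nu.-integrable [set: X] (EFin \o (fun x => ln (1 + (t + s * a x)))).
Proof.
move=> t0 s0; have b0 x : 0 <= t + s * a x by rewrite addr_ge0// mulr_ge0.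
apply: (@bounded_measurable_integrable _ _ _ _ _ (t + s * M)).
- by rewrite -ge0_fin_numE ?fin_num_measure.
- apply: measurableT_comp => //; apply: measurable_funD => //.
  by apply: measurable_funD => //; exact: measurable_funM.
- by move=> x; rewrite ln_ge0// lerDl.
- move=> x; rewrite (le_trans (le_ln1Dx _))//.
    by rewrite (lt_le_trans _ (b0 x))// ltrN10.
  by rewrite lerD2l ler_wpM2l.
Qed.

Lemma gamma_laplace2 (t s : R) : 0 <= t -> 0 <= s ->
  (\int[P]_eta (expR (- (t * S eta + s * F eta)))%:E =
   (expR (- \int[nu]_x ln (1 + (t + s * a x))))%:E)%E.
Proof.
move=> t0 s0.
rewrite -(@gamma_laplace (fun x => t + s * a x) (t + s * M)); first last.
- by move=> x; rewrite lerD2l ler_wpM2l.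
- by move=> x; rewrite addr_ge0// mulr_ge0.
- by apply: measurable_funD => //; exact: measurable_funM.
apply: eq_integral => eta _; congr (expR (- _))%:E.
have etaoo := dmeasure_finite eta.
have ia := bounded_measurable_integrable etaoo ma a0 aM.
rewrite RintegralD//; last 2 first.
- exact: (bounded_measurable_integrable etaoo _ _ (fun=> lexx t)).
- apply: (@bounded_measurable_integrable _ _ _ _ _ (s * M)) => //.
  + exact: measurable_funM.
  + by move=> x; rewrite mulr_ge0.
  + by move=> x; rewrite ler_wpM2l.
by rewrite Rintegral_cst// RintegralZl.
Qed.

(** The two arguments of the logarithm in the Laplace functional differ by the
factor [c], which contributes [ln c] times the mass [theta] of [nu]. *)
Lemma gamma_quasi_inv (c t s : R) : 0 < c -> 0 <= t -> 0 <= s ->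
  1 <= (1 + t) * c ->
  (\int[P]_w (expR (- (((1 + t) * c - 1) * S w + c * s * F w)))%:E =
   (c `^ (- theta))%:E * \int[P]_w (expR (- (t * S w + s * F w)))%:E)%E.
Proof.
move=> c0 t0 s0 tc.
rewrite !gamma_laplace2// ?subr_ge0//; last by rewrite mulr_ge0// ltW.
rewrite -EFinM /powR gt_eqF// -expRD; congr (expR _)%:E.
have b0 x : 0 < 1 + (t + s * a x).
  by rewrite addrA ltr_wpDr ?mulr_ge0// ltr_wpDr.
transitivity (- \int[nu]_x (ln c + ln (1 + (t + s * a x)))).
  congr (- _); apply: eq_Rintegral => x _; rewrite -lnM ?posrE//.
  by congr ln; ring.
rewrite RintegralD//; last first.
- exact: lnint.
- by apply: finite_measure_integrable_cst.
by rewrite Rintegral_cst// [fine _](congr1 fine nuT)/=; ring.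
Qed.

Lemma total_mass_gt0_ae : {ae P, forall eta, 0 < S eta}.
Proof.
exact: (quasi_inv_gt0_ae theta0 measurable_total_mass measurable_bounded_functional
  total_mass_ge0 gamma_quasi_inv).
Qed.

(** The identity of the theorem for bounded [a], cleared of the quotient
[F / S]. *)
Lemma markov_krein_bounded (z : R) : 0 <= z ->
  (\int[P]_eta ((S eta + z * F eta) `^ (- theta) * S eta `^ theta)%:E =
   (expR (- \int[nu]_x ln (1 + z * a x)))%:E)%E.
Proof.
move=> z0.
rewrite (quasi_inv_identity theta0 measurable_total_mass
  measurable_bounded_functional total_mass_ge0 bounded_functional_ge0
  gamma_quasi_inv z0).
have e eta : z * F eta = 0 * S eta + z * F eta by rewrite mul0r add0r.
under eq_integral do rewrite e.
rewrite gamma_laplace2//; congr (expR (- _))%:E.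
by apply: eq_Rintegral => x _; rewrite add0r.
Qed.

End bounded_functional.
End gamma_process.

(** * Passage to unbounded functionals *)
Lemma cvg_Rintegral_ln1D (R : realType) d (X : measurableType d)
    (mu : {measure set X -> \bar R}) (b_ : nat -> X -> R) (b c : X -> R) :
  (forall n, measurable_fun [set: X] (b_ n)) ->
  measurable_fun [set: X] b ->
  (forall n x, 0 <= b_ n x) -> (forall n x, b_ n x <= c x) ->
  mu.-integrable [set: X] (EFin \o (fun x => ln (1 + c x))) ->
  (forall x, b_ n x @[n --> \oo] --> b x) ->
  \int[mu]_x ln (1 + b_ n x) @[n --> \oo] --> \int[mu]_x ln (1 + b x).
Proof.
move=> mb_ mb b0 bc ic cvb.
have mln (f : X -> R) : measurable_fun [set: X] f ->
    measurable_fun [set: X] (fun x => (ln (1 + f x))%:E).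
  move=> mf; apply/measurable_EFinP; apply: measurableT_comp => //.
  exact: measurable_funD.
have cvln : {ae mu, forall x, [set: X] x ->
    (ln (1 + b_ n x))%:E @[n --> \oo] --> (ln (1 + b x))%:E}.
  apply: aeW => x _; apply: cvg_EFin; first exact: nearW.
  have bx0 : 0 <= b x.
    rewrite -(cvg_lim _ (cvb x))//; apply: limr_ge; last exact: nearW.
    by apply: cvgP; exact: cvb.
  apply: continuous_cvg; first by apply: continuous_ln; rewrite ltr_wpDr.
  by apply: cvgD => //; exact: cvg_cst.
have dom : {ae mu, forall x n, [set: X] x ->
    (`|(ln (1 + b_ n x))%:E| <= (ln (1 + c x))%:E)%E}.
  apply: aeW => x n _; rewrite gee0_abs ?lee_fin ?ln_ge0 ?lerDl//.
  have b0' : 0 < 1 + b_ n x by rewrite ltr_wpDr.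
  by rewrite ler_ln ?posrE ?lerD2l// (lt_le_trans b0')// lerD2l.
have [ib _ cvI] := dominated_convergence measurableT (fun n => mln _ (mb_ n))
  (mln _ mb) cvln ic dom.
by apply: fine_cvg; rewrite fineK//; exact: integrable_fin_num.
Qed.

Lemma integrable_ln1DM (R : realType) d (X : measurableType d)
    (mu : {finite_measure set X -> \bar R}) (a : X -> R) (z : R) :
  measurable_fun [set: X] a -> (forall x, 0 <= a x) -> 0 <= z ->
  mu.-integrable [set: X] (EFin \o (fun x => ln (1 + a x))) ->
  mu.-integrable [set: X] (EFin \o (fun x => ln (1 + z * a x))).
Proof.
move=> ma a0 z0 ia.
have ic : mu.-integrable [set: X] (fun x => ((ln (1 + z))%:E + (ln (1 + a x))%:E)%E).
  by apply: integrableD => //; exact: finite_measure_integrable_cst.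
apply: (le_integrable _ _ _ ic) => //.
  apply/measurable_EFinP; apply: measurableT_comp => //.
  by apply: measurable_funD => //; exact: measurable_funM.
move=> x _ /=; have az0 : 0 <= z * a x by rewrite mulr_ge0.
rewrite lee_fin !ger0_norm ?addr_ge0 ?ln_ge0 ?lerDl//.
rewrite -lnM ?posrE ?ltr_wpDr// ler_ln ?posrE ?mulr_gt0 ?ltr_wpDr//.
by rewrite -subr_ge0 (_ : _ - _ = z + a x) ?addr_ge0//; ring.
Qed.

Section unbounded_functional.
Context (R : realType) d (X : measurableType d).
Context (nu : {finite_measure set X -> \bar R}) (theta : R).
Context (P : probability (discrete_space R X) R) (a : X -> R).
Hypothesis nuT : nu [set: X] = theta%:E.
Hypothesis theta0 : 0 < theta.
Hypothesis gammaP : gamma_measure nu P.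
Hypothesis ma : measurable_fun [set: X] a.
Hypothesis a0 : forall x, 0 <= a x.
Hypothesis ia : nu.-integrable [set: X] (EFin \o (fun x => ln (1 + a x))).

Let S (eta : discrete_space R X) : R := fine (eta [set: X]).

Let a_ (n : nat) (x : X) : R := Num.min (a x) n%:R.

Let ma_ n : measurable_fun [set: X] (a_ n).
Proof. exact: measurable_minr. Qed.

Let a_0 n x : 0 <= a_ n x.
Proof. by rewrite /a_ le_min a0 ler0n. Qed.

Let a_n n x : a_ n x <= n%:R.
Proof. by rewrite /a_ ge_min lexx orbT. Qed.

Let a_a n x : a_ n x <= a x.
Proof. by rewrite /a_ ge_min lexx. Qed.

Let nd_a_ x m n : (m <= n)%N -> a_ m x <= a_ n x.
Proof. by move=> mn; rewrite /a_ le_min !ge_min lexx ler_nat mn orbT. Qed.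

Let cvg_a_ x : a_ n x @[n --> \oo] --> a x.
Proof.
apply: cvg_near_cst; near=> n; apply/min_idPl.
by near: n; exact: nbhs_infty_ger.
Unshelve. all: by end_near. Qed.

Let F_ n (eta : discrete_space R X) : R := \int[eta]_x a_ n x.

Let G (eta : discrete_space R X) : \bar R := (\int[eta]_x (a x)%:E)%E.

Let G0 eta : (0 <= G eta)%E.
Proof. by apply: integral_ge0 => x _; rewrite lee_fin. Qed.

Let mG : measurable_fun [set: discrete_space R X] G.
Proof. by apply: measurable_integral => //; exact/measurable_EFinP. Qed.

Let F_0 n eta : 0 <= F_ n eta.
Proof. exact: Rintegral_ge0. Qed.

Let mF_ n : measurable_fun [set: discrete_space R X] (F_ n).
Proof. exact: measurable_bounded_functional. Qed.

Let cvg_F_ eta : (F_ n eta)%:E @[n --> \oo] --> G eta.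
Proof.
have FE n : (F_ n eta)%:E = (\int[eta]_x (a_ n x)%:E)%E.
  rewrite fineK//; apply: integrable_fin_num => //.
  exact: (bounded_measurable_integrable (dmeasure_finite eta) (@ma_ n) (a_0 n) (a_n n)).
under eq_fun do rewrite FE.
rewrite /G (_ : integral _ _ _ = \int[eta]_x limn (fun n => (a_ n x)%:E))%E; last first.
  apply: eq_integral => x _; apply/esym/cvg_lim => //.
  by apply: cvg_EFin; [exact: nearW|exact: cvg_a_].
apply: cvg_monotone_convergence => //.
- by move=> n; exact/measurable_EFinP.
- by move=> n x _; rewrite lee_fin.
- by move=> x _ m n mn; rewrite lee_fin nd_a_.
Qed.

Let cvg_RHS z : 0 <= z ->
  (expR (- \int[nu]_x ln (1 + z * a_ n x)))%:E @[n --> \oo] -->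
  (expR (- \int[nu]_x ln (1 + z * a x)))%:E.
Proof.
move=> z0; apply: cvg_EFin; first exact: nearW.
apply: continuous_cvg; first exact: continuous_expR.
apply: cvgN; apply: (cvg_Rintegral_ln1D (c := fun x => z * a x)).
- by move=> n; exact: measurable_funM.
- exact: measurable_funM.
- by move=> n x; rewrite mulr_ge0.
- by move=> n x; rewrite ler_wpM2l.
- exact: integrable_ln1DM.
- by move=> x; apply: cvgM => //; exact: cvg_cst.
Qed.

Let finG := [set eta : discrete_space R X | (G eta < +oo)%E].

Let mfinG : measurable finG.
Proof.
rewrite (_ : finG = [set: _] `&` [set eta | G eta \is a fin_num]).
  exact: emeasurable_fin_num.
by apply/seteqP; split=> eta; rewrite /= ge0_fin_numE//; case.
Qed.

(** Bounds from below the probability that the integral of [a] is finite: as [n]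
grows, the integrand [exp (- z F_n)] decreases to [exp (- z F)] where [F] is
finite and to [0] elsewhere. *)
Let laplace_le_finG z : 0 < z ->
  ((expR (- \int[nu]_x ln (1 + z * a x)))%:E <= P finG)%E.
Proof.
move=> z0.
pose xi eta : R := \1_finG eta * expR (- (z * fine (G eta))).
have mxi : measurable_fun [set: discrete_space R X] (EFin \o xi).
  apply/measurable_EFinP; apply: measurable_funM; first exact: measurable_indic.
  apply: measurableT_comp => //; apply: measurableT_comp => //.
  by apply: measurable_funM => //; exact: (measurableT_comp (f := @fine R)).
have cvxi eta : (expR (- (z * F_ n eta)))%:E @[n --> \oo] --> (xi eta)%:E.
  apply: cvg_EFin; first exact: nearW.
  have := @cvg_F_ eta; rewrite /xi indicE.
  have [Goo|/negP] := boolP (G eta < +oo)%E.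
    rewrite mem_set// mul1r -{1}(fineK (x := G eta)) ?ge0_fin_numE//.
    move=> /fine_cvg cvF; apply: continuous_cvg; first exact: continuous_expR.
    by apply: cvgN; apply: cvgM; first exact: cvg_cst.
  move=> nGoo; rewrite memNset// mul0r.
  have -> : G eta = +oo%E.
    by move: nGoo (G0 eta); case: (G eta) => // r; rewrite ltry.
  move=> /cvgeryP cvF.
  have cvE : expR (- (z * y)) @[y --> +oo] --> 0.
    apply: (@cvg_comp _ _ _ (fun y => z * y) (fun y => expR (- y)) _ (+oo%R)).
      exact: gt0_cvgMry.
    exact: cvgr_expR.
  exact: (cvg_comp _ _ cvF cvE).
have cvI : (\int[P]_eta (expR (- (z * F_ n eta)))%:E @[n --> \oo] -->
    \int[P]_eta (xi eta)%:E)%E.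
  apply: (@dominated_cvg _ _ _ P setT measurableT _ _ (cst 1%E)) => //.
  - move=> n; apply/measurable_EFinP; apply: measurableT_comp => //.
    by apply: measurableT_comp => //; exact: measurable_funM.
  - exact: finite_measure_integrable_cst.
  - move=> n eta _; rewrite gee0_abs ?lee_fin ?expR_ge0// -expR0 ler_expR.
    by rewrite oppr_le0 mulr_ge0// ltW.
have FE n : (\int[P]_eta (expR (- (z * F_ n eta)))%:E =
    (expR (- \int[nu]_x ln (1 + z * a_ n x)))%:E)%E.
  have := gamma_laplace2 gammaP (@ma_ n) (a_0 n) (a_n n) (lexx 0) (ltW z0).
  by under eq_integral do rewrite mul0r add0r; move=> ->; under eq_Rintegral do rewrite add0r.
have -> : (expR (- \int[nu]_x ln (1 + z * a x)))%:E = (\int[P]_eta (xi eta)%:E)%E.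
  move: cvI; under eq_fun do rewrite FE.
  by apply: cvg_unique => //; exact: cvg_RHS (ltW z0).
rewrite -(setIT finG) -integral_indic//; apply: ge0_le_integral => //.
- by move=> eta _; rewrite lee_fin mulr_ge0 ?expR_ge0.
- exact/measurable_EFinP/measurable_indic.
- move=> eta _; rewrite lee_fin /xi ler_piMr// -expR0 ler_expR oppr_le0.
  by rewrite mulr_ge0 ?fine_ge0// ltW.
Qed.

(** The lower bound [laplace_le_finG] tends to [1] as [z] tends to [0]; the
sequence [z = 1 / (n + 1)] is used. *)
Lemma functional_finite_ae : {ae P, forall eta : discrete_space R X,
  (\int[eta]_x (a x)%:E < +oo)%E}.
Proof.
exists (~` finG); split => //; first exact: measurableC.
rewrite probability_setC//.
suff -> : P finG = 1%E by rewrite subee.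
apply/eqP; rewrite eq_le probability_le1//=.
have cv1 : (expR (- \int[nu]_x ln (1 + n.+1%:R^-1 * a x)))%:E @[n --> \oo] --> 1%E.
  rewrite -[X in _ --> X]/(1%:E) -[in X in _ --> X]expR0 -oppr0.
  apply: cvg_EFin; first exact: nearW.
  apply: continuous_cvg; first exact: continuous_expR.
  apply: cvgN.
  have <- : \int[nu]_x ln (1 + cst 0 x) = 0.
    by under eq_Rintegral do rewrite addr0 ln1; rewrite Rintegral_cst// mul0r.
  apply: (cvg_Rintegral_ln1D (c := a)) => //.
  - by move=> n; exact: measurable_funM.
  - by move=> n x; rewrite mulr_ge0.
  - by move=> n x; rewrite ler_piMl// invf_le1 ?ler1n.
  - move=> x; rewrite -(mul0r (a x)); apply: cvgM; last exact: cvg_cst.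
    exact: cvg_harmonic.
apply: (cvge_le _ cv1); apply: nearW => n; apply: laplace_le_finG.
by rewrite invr_gt0.
Qed.

(** The quotients [S / (S + z F_n)] are at most [1] and converge almost surely,
since [S] is positive and [F] finite; so the bounded case passes to the
limit. *)
Lemma markov_krein_gamma (z : R) : 0 <= z ->
  (\int[P]_eta ((S eta + z * \int[eta]_x a x) `^ (- theta) *
      S eta `^ theta)%:E =
   (expR (- \int[nu]_x ln (1 + z * a x)))%:E)%E.
Proof.
move=> z0.
pose h (y : R) eta : \bar R := ((S eta + z * y) `^ (- theta) * S eta `^ theta)%:E.
have mS : measurable_fun [set: discrete_space R X] S by exact: measurable_total_mass.
have mh (Y : discrete_space R X -> R) : measurable_fun [set: discrete_space R X] Y ->
    measurable_fun [set: discrete_space R X] (fun eta => h (Y eta) eta).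
  move=> mY; apply/measurable_EFinP; apply: measurable_funM.
    apply: (measurableT_comp (measurable_powR _)).
    by apply: measurable_funD => //; exact: measurable_funM.
  exact: (measurableT_comp (measurable_powR _)).
have S0 eta : 0 <= S eta by exact: total_mass_ge0.
have Spos : {ae P, forall eta, 0 < S eta}.
  exact: (total_mass_gt0_ae nuT theta0 gammaP (ma_ 0) (a_0 0) (a_n 0)).
have cvh : {ae P, forall eta, [set: discrete_space R X] eta ->
    h (F_ n eta) eta @[n --> \oo] --> h (fine (G eta)) eta}.
  near=> eta => _.
  have Seta : 0 < S eta by near: eta.
  have Geta : (G eta < +oo)%E by near: eta; exact: functional_finite_ae.
  have := @cvg_F_ eta; rewrite -{1}(fineK (x := G eta)) ?ge0_fin_numE//.
  move=> /fine_cvg cvF.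
  suff cvN : (S eta + z * F_ n eta) `^ (- theta) @[n --> \oo] -->
      (S eta + z * fine (G eta)) `^ (- theta).
    apply: cvg_EFin; first exact: nearW.
    exact: (cvgM cvN (@cvg_cst _ _ _ _ _)).
  have N0 y : 0 <= y -> 0 < S eta + z * y by move=> y0; rewrite ltr_wpDr ?mulr_ge0.
  rewrite /powR (gt_eqF (N0 _ (fine_ge0 (G0 eta)))).
  under eq_fun do rewrite (gt_eqF (N0 _ (F_0 _ eta))).
  apply: continuous_cvg; first exact: continuous_expR.
  apply: cvgM; first exact: cvg_cst.
  apply: continuous_cvg; first by apply: continuous_ln; rewrite N0 ?fine_ge0.
  apply: cvgD; first exact: cvg_cst.
  by apply: cvgM => //; exact: cvg_cst.
have h1 : {ae P, forall eta n, [set: discrete_space R X] eta ->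
    (`|h (F_ n eta) eta| <= cst 1%E eta)%E}.
  apply: filterS Spos => eta Seta n _.
  have N1 : S eta <= S eta + z * F_ n eta by rewrite lerDl mulr_ge0.
  have Npos := lt_le_trans Seta N1.
  rewrite gee0_abs ?lee_fin ?mulr_ge0 ?powR_ge0// powRN mulrC.
  rewrite ler_pdivrMr ?powR_gt0// mul1r ge0_ler_powR ?nnegrE//; exact: ltW.
have mfG : measurable_fun [set: discrete_space R X] (fine \o G).
  exact: (measurableT_comp (f := @fine R)).
have [_ _] := dominated_convergence measurableT (fun n => mh _ (@mF_ n))
  (mh _ mfG) cvh
  (finite_measure_integrable_cst P 1 measurableT) h1.
rewrite (_ : [sequence _]_n = fun n => (expR (- \int[nu]_x ln (1 + z * a_ n x)))%:E).
  by move=> cvI; apply: (cvg_unique _ cvI) => //; exact: cvg_RHS.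
by apply/funext => n; exact: (markov_krein_bounded nuT theta0 gammaP (@ma_ n) (a_0 n) (a_n n) z0).
Unshelve. all: by end_near. Qed.

End unbounded_functional.

(** Compare [1 + a] with [2] where [a <= 1] and with [2 a] where [a > 1]; where
[a] vanishes, [lne (a x)] is infinite and the bound is trivial. *)
Lemma integrable_ln1D (R : realType) d (X : measurableType d)
    (mu : {finite_measure set X -> \bar R}) (a : X -> R) :
  measurable_fun [set: X] a -> (forall x, 0 <= a x) ->
  (\int[mu]_x `|lne (a x)%:E| < +oo)%E ->
  mu.-integrable [set: X] (EFin \o (fun x => ln (1 + a x))).
Proof.
move=> ma a0 lna.
have mlna : measurable_fun [set: X] (fun x => `|lne (a x)%:E|%E).
  apply: measurableT_comp => //.
  apply: (measurable_fun_ifT (f := fun x => a x <= 0)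
    (g := fun=> -oo%E) (h := fun x => (ln (a x))%:E)) => //.
  - by apply: measurable_fun_ler.
  - by apply/measurable_EFinP; exact: measurableT_comp.
apply/integrableP; split.
  apply/measurable_EFinP; apply: measurableT_comp => //.
  exact: measurable_funD.
apply: (@le_lt_trans _ _ (\int[mu]_x ((ln 2)%:E + `|lne (a x)%:E|))%E).
  apply: ge0_le_integral => //.
  - apply/measurableT_comp => //.
    apply/measurable_EFinP; apply: measurableT_comp => //.
    exact: measurable_funD.
  - by apply: emeasurable_funD.
  - move=> x _; rewrite gee0_abs ?lee_fin ?ln_ge0 ?lerDl//.
    have [ax0|ax0] := leP (a x) 0.
      by rewrite le0_lneNy ?lee_fin//= addey// leey.
    rewrite lne_EFin//= -EFinD lee_fin.
    have [a1|a1] := leP (a x) 1.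
      rewrite -[leLHS]addr0 lerD// ler_ln ?posrE//; last by rewrite ltr_wpDr// ltW.
      by rewrite -[2]/(1 + 1) lerD2l.
    apply: (@le_trans _ _ (ln 2 + ln (a x))); last by rewrite lerD2l ler_norm.
    rewrite -lnM ?posrE// ler_ln ?posrE ?mulr_gt0 ?addr_gt0//.
    by rewrite mulrDl !mul1r lerD2r ltW.
rewrite ge0_integralD//; last by move=> x _; rewrite lee_fin ln_ge0// ler1n.
rewrite integral_cst// lte_add_pinfty// lte_mul_pinfty ?lee_fin ?ln_ge0 ?ler1n//.
by rewrite -ge0_fin_numE// fin_num_measure.
Qed.

(** The positive and the negative part of [f] are transferred separately, as
nonnegative functions. *)
Lemma integral_distribution_real (R : realType) d (X : measurableType d)
    (Q : probability X R) (a : {mfun X >-> R}) (f : R -> R) :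
  measurable_fun [set: R] f ->
  (\int[distribution Q a]_u (f u)%:E = \int[Q]_x (f (a x))%:E)%E.
Proof.
move=> mf; have mfE : measurable_fun [set: R] (EFin \o f) by exact/measurable_EFinP.
rewrite integralE [RHS]integralE.
rewrite !(ge0_integral_distribution a)//; last 2 first.
- exact: measurable_funeneg.
- exact: measurable_funepos.
by rewrite -funepos_comp -funeneg_comp.
Qed.

Unset Implicit Arguments.

Theorem theorem9 (R : realType) (d : measure_display) (X : measurableType d)
    (nu : {finite_measure set X -> \bar R}) (theta : R)
    (P : probability (discrete_space R X) R) (a : {mfun X >-> R})
    (hX : standard_borel R X) (hnu : nonatomic nu)
    (htheta : nu [set: X] = theta%:E) (htheta0 : 0 < theta)
    (hP : gamma_measure nu P)
    (ha0 : forall x, 0 <= a x)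
    (ha : (\int[nu]_x `|lne (a x)%:E| < +oo)%E) :
  let mu_a := distribution (normalized_law P) (linear_functional a) in
  let nu_a := distribution (mnormalize nu \d_point) a in
  forall z : R, 0 <= z ->
    (\int[mu_a]_u ((1 + z * u) `^ theta)^-1%:E =
       expeR (- \int[nu_a]_u (theta * ln (1 + z * u))%:E))%E.
Proof.
move=> mu_a nu_a z z0.
have ma : measurable_fun [set: X] a by [].
have ia := integrable_ln1D ma ha0 ha.
have mfrac (p : R) : measurable_fun [set: R] (fun u => (1 + z * u) `^ p).
  apply: (measurableT_comp (measurable_powR p)).
  by apply: measurable_funD => //; exact: measurable_funM.
have mlnz : measurable_fun [set: R] (fun u => ln (1 + z * u)).
  apply: measurableT_comp => //.
  by apply: measurable_funD => //; exact: measurable_funM.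
have mlnza : measurable_fun [set: X] (fun x => ln (1 + z * a x)).
  exact: (measurableT_comp mlnz).
have lnza0 x : 0 <= ln (1 + z * a x) by rewrite ln_ge0// lerDl mulr_ge0.
have RHSE : (\int[nu_a]_u (theta * ln (1 + z * u))%:E =
    (\int[nu]_x ln (1 + z * a x))%:E)%E.
  rewrite /nu_a integral_distribution_real; last exact: measurable_funM.
  rewrite (integral_mnormalize _ htheta)//; last first.
  - by move=> x; rewrite lee_fin mulr_ge0// ltW.
  - by apply/measurable_EFinP; exact: measurable_funM.
  under eq_integral do rewrite EFinM.
  rewrite ge0_integralZl//; last 3 first.
  - exact/measurable_EFinP.
  - by move=> x _; rewrite lee_fin.
  - by rewrite lee_fin ltW.
  rewrite muleA -EFinM mulVf ?gt_eqF// mul1e fineK//.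
  apply: integrable_fin_num => //; exact: (integrable_ln1DM ma ha0 z0 ia).
rewrite RHSE /= -(markov_krein_gamma htheta htheta0 hP ma ha0 ia z0).
under eq_integral do rewrite -powRN.
have fpow u : (0 <= ((1 + z * u) `^ (- theta))%:E)%E by rewrite lee_fin powR_ge0.
have mpow : measurable_fun [set: R] (fun u => ((1 + z * u) `^ (- theta))%:E).
  exact/measurable_EFinP.
have mLF := measurable_linear_functional a.
rewrite (ge0_integral_distribution (linear_functional a))//.
rewrite (ge0_integral_distribution (@normalization R d X))//; last 2 first.
- exact: (measurableT_comp mpow mLF).
- by move=> eta; exact: fpow.
(* the positivity of the total mass is a special case for the zero functional *)
have mcst0 : measurable_fun [set: X] (cst 0 : X -> R) by [].
have Spos := total_mass_gt0_ae htheta htheta0 hP mcst0 (fun=> lexx 0) (fun=> lexx 0).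
apply: ge0_ae_eq_integral => //.
- exact: (measurableT_comp mpow (measurableT_comp mLF (@measurable_normalization R d X))).
- apply/measurable_EFinP; apply: measurable_funM; last first.
    by apply: (measurableT_comp (measurable_powR _)); exact: measurable_total_mass.
  apply: (measurableT_comp (measurable_powR _)).
  apply: measurable_funD; first exact: measurable_total_mass.
  by apply: measurable_funM => //; exact: (measurable_linear_functional a).
- by move=> eta _; exact: fpow.
- by move=> eta _; rewrite lee_fin mulr_ge0 ?powR_ge0.
apply: filterS Spos => eta Seta _; congr EFin.
rewrite /= /linear_functional /Rintegral.
have maE : measurable_fun [set: X] (EFin \o a) by exact/measurable_EFinP.
have aE0 x : (0 <= (EFin \o a) x)%E by rewrite lee_fin.
rewrite (integral_mnormalize _ (total_massE eta) Seta maE aE0).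
rewrite fine_gt0_muleEFin ?invr_gt0//; set s := fine (eta _) in Seta *; set f := fine _.
have f0 : 0 <= f by apply: fine_ge0; apply: integral_ge0 => x _; exact: aE0.
have -> : 1 + z * (s^-1 * f) = (s + z * f) * s^-1.
  by rewrite mulrDl mulfV ?gt_eqF//; ring.
rewrite powRM ?invr_ge0 ?addr_ge0 ?mulr_ge0 ?(ltW Seta)//.
by congr (_ * _); rewrite -powR_inv1 ?(ltW Seta)// -powRrM mulN1r opprK.
Qed.
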